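(* Let $P,Q,R\in\mathbb{Z}$ and let $u=(u_n)_{n\ge 1}$ be the sequence of integers defined by $u_1=1$, $u_2=R$ and $u_{n+2}=Pu_{n+1}-Qu_n$ for all $n\ge 1$. Then $u$ is a strong divisibility sequence if and only if at least one of the following holds: (i) there exist coprime integers $P',Q'$ such that $u_n=U_n(P',Q')$ for all $n\ge 1$ (i.e. $u$ is a Lucas sequence with coprime parameters); (ii) there exist $r\in\mathbb{Z}$ and $\varepsilon\in\{1,-1\}$ such that $u=(1,r,\varepsilon,\varepsilon r,1,r,\dots)$, that is, $u_1=1$, $u_2=r$ and $u_{n+2}=\varepsilon u_n$ for all $n\ge 1$; (iii) there exists $\varepsilon\in\{1,-1\}$ such that $u=(1,\varepsilon,-1,\varepsilon,-1,\dots)$, that is, $u_1=1$, $u_n=\varepsilon$ for all even $n\ge 2$, and $u_n=-1$ for all odd $n\ge 3$; (iv) there exists $\varepsilon\in\{1,-1\}$ such that $u=(1,\varepsilon,-2,\varepsilon,1,-2\varepsilon,1,\varepsilon,\dots)$, that is, $(u_1,u_2,u_3,u_4,u_5,u_6)=(1,\varepsilon,-2,\varepsilon,1,-2\varepsilon)$ and $u_{n+6}=u_n$ for all $n\ge 1$.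
   Context: For integers $a,b$, $a\land b$ denotes their nonnegative greatest common divisor (with $a\land 0=|a|$, in particular $0\land 0=0$). A sequence of integers $(u_n)_{n\ge1}$ is a strong divisibility sequence if $u_i\land u_j=|u_{i\land j}|$ for all integers $i,j\ge 1$. For $P',Q'\in\mathbb{Z}$, the Lucas sequence $U(P',Q')=(U_n(P',Q'))_{n\ge 0}$ is defined by $U_0=0$, $U_1=1$ and $U_{n+2}=P'U_{n+1}-Q'U_n$ for all $n\ge 0$. *)

(* Defs.v *)
From mathcomp Require Import all_boot all_order all_algebra.

Set Implicit Arguments.
Unset Strict Implicit.
Unset Printing Implicit Defensive.

Import Order.TTheory GRing.Theory Num.Theory.
Local Open Scope ring_scope.

(* Sequences indexed by n >= 1 are functions nat -> int whose value at 0 is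
   never looked at. *)
Definition strong_divisibility (u : nat -> int) : Prop :=
  forall i j : nat, (1 <= i)%N -> (1 <= j)%N ->
    gcdz (u i) (u j) = `|u (gcdn i j)|.

Fixpoint lucasU (P Q : int) (n : nat) : int :=
  match n with
  | 0%N => 0
  | 1%N => 1
  | (m.+1 as k).+1 => P * lucasU P Q k - Q * lucasU P Q m
  end.

(* Main.v *)
Require Import Defs.
From mathcomp Require Import all_boot all_order all_algebra.
From mathcomp Require Import zify ring.

Set Implicit Arguments.
Unset Strict Implicit.
Unset Printing Implicit Defensive.

Import Order.TTheory GRing.Theory Num.Theory.
Local Open Scope ring_scope.

(** Write [U] for the Lucas sequence of parameters [P] and [Q], and let [u] be a
    strong divisibility sequence obeying the same recurrence.  Coprimality of
    consecutive terms makes [P] and [Q] coprime, and [u_2 | u_4] gives [R | P].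
    The key fact is that every term divides [P - R] ([strong_rec_dvd]): the
    addition formula ([rec_add]) turns [u_n | u_(2n)] into [u_n | U_n], while
    [u_n = U_n - (P - R) U_(n-1)] with [U_n] and [U_(n-1)] coprime.

    If [P = R], then [u = U].  Otherwise [P - R] is nonzero, so all terms are
    bounded by it, and it is enough to look at [u_3], [u_4] and [u_5].  Put
    [P = k R], [s = R ^ 2] and [a = u_3].  Since [u_3] and [u_4 / R] are coprime
    divisors of [k - 1], there is [e] with [k - 1 = a e], and
    [u_4 / R = e a (a - s) + (2 a - s)] divides [e].  The left-hand side is a
    multiple of [e] up to a small offset, which is why almost all [(a, e)] are
    excluded ([ratio_cases_one], [ratio_cases_four]).  The survivors are
    [P = 0], the constant-ratio sequence with [R = 1] or [R = -1], and the
    parameters [(P, Q) = (-R, 0)] and [(-R, 1)] of the two sporadic families.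

    Conversely, Lucas sequences with coprime parameters satisfy the Euclidean
    algorithm on indices ([strong_lucasU]), and in every other family
    [|u_n|] takes one value at the multiples of a fixed [d] and is 1 elsewhere
    ([strong_of_two_values]). *)

(** * Lucas sequences and sequences with the same recurrence *)

Definition satisfies_rec (P Q : int) (u : nat -> int) :=
  forall n : nat, (1 <= n)%N -> u n.+2 = P * u n.+1 - Q * u n.

Lemma lucasUSS P Q n :
  lucasU P Q n.+2 = P * lucasU P Q n.+1 - Q * lucasU P Q n.
Proof. by []. Qed.

Lemma rec_add P Q u n m : satisfies_rec P Q u -> (1 <= n)%N ->
  u (n + m.+1)%N = u n.+1 * lucasU P Q m.+1 - Q * u n * lucasU P Q m.
Proof.
move=> hu n1.
suff: u (n + m.+1)%N = u n.+1 * lucasU P Q m.+1 - Q * u n * lucasU P Q m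
   /\ u (n + m.+2)%N = u n.+1 * lucasU P Q m.+2 - Q * u n * lucasU P Q m.+1.
  by case.
elim: m => [|m [IH1 IH2]].
  by rewrite addn1 addn2 hu //=; split; ring.
split=> //; rewrite !addnS hu //.
by rewrite -!addnS IH1 IH2 !lucasUSS; ring.
Qed.

Lemma rec_lucasU P Q u m : satisfies_rec P Q u -> u 1%N = 1 ->
  u m.+1 = lucasU P Q m.+1 - (P - u 2%N) * lucasU P Q m.
Proof.
move=> hu u1; case: m => [|m]; first by rewrite u1 /=; ring.
by rewrite -[m.+2]add1n (rec_add m hu) // u1 lucasUSS; ring.
Qed.

Lemma gcdz_add_mull (k m n : int) : gcdz (k * m + n) m = gcdz n m.
Proof. by rewrite gcdzC gcdzMDl gcdzC. Qed.

Section CoprimeLucas.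

Variables P Q : int.
Hypothesis coPQ : coprimez P Q.
Local Notation U := (lucasU P Q).

Lemma coprime_lucasU_Q n : coprimez (U n.+1) Q.
Proof.
elim: n => [|n IH]; first by rewrite /= /coprimez gcd1z.
rewrite lucasUSS /coprimez.
have -> : P * U n.+1 - Q * U n = (- U n) * Q + P * U n.+1 by ring.
by rewrite gcdz_add_mull -/(coprimez _ _) coprimezMl coPQ.
Qed.

Lemma coprime_lucasU_succ n : coprimez (U n.+1) (U n).
Proof.
elim: n => [|n IH]; first by rewrite /= /coprimez gcdz0.
rewrite lucasUSS /coprimez.
have -> : P * U n.+1 - Q * U n = P * U n.+1 + (- Q) * U n by ring.
rewrite gcdz_add_mull -/(coprimez _ _) coprimezMl coprimeNz.
by rewrite ![coprimez _ (U n.+1)]coprimez_sym coprime_lucasU_Q IH.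
Qed.

(** Modulo [U_n], the addition formula reads [U_(n+m) = U_(n+1) U_m], and
    [U_(n+1)] is invertible. *)
Lemma gcd_lucasU_add n m : (1 <= n)%N -> (1 <= m)%N ->
  gcdz (U (n + m)%N) (U n) = gcdz (U m) (U n).
Proof.
case: m => // m n1 _; rewrite (@rec_add P Q) //.
have -> : U n.+1 * U m.+1 - Q * U n * U m
          = (- (Q * U m)) * U n + U n.+1 * U m.+1 by ring.
rewrite gcdz_add_mull gcdzC Gauss_gcdzr 1?gcdzC //.
by rewrite coprimez_sym coprime_lucasU_succ.
Qed.

Lemma strong_lucasU : strong_divisibility U.
Proof.
move=> i j; have [N] := ubnP (i + j)%N.
elim: N i j => // N IH i j ltN i1 j1.
wlog le_ij : i j ltN i1 j1 / (i <= j)%N => [wl|].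
  have [/wl|/ltnW /wl] := leqP i j; first exact.
  by rewrite gcdzC gcdnC addnC; apply.
move: le_ij; rewrite leq_eqVlt => /predU1P[->|lt_ij].
  by rewrite gcdzz gcdnn.
rewrite -(subnKC (ltnW lt_ij)) gcdzC gcd_lucasU_add ?subn_gt0 //.
rewrite gcdnDl gcdzC IH ?subn_gt0 //.
by rewrite (leq_trans _ (ltN : (i + j <= N)%N)) // ltn_add2l; lia.
Qed.

End CoprimeLucas.

(** * Strong divisibility of the exceptional families *)

(** [d] divides [gcdn i j] exactly when it divides both [i] and [j]. *)
Lemma strong_of_two_values (d c : nat) (u : nat -> int) :
  (forall n, (1 <= n)%N -> `|u n|%N = if (d %| n)%N then c else 1%N) ->
  strong_divisibility u.
Proof.
move=> abs_u i j i1 j1; rewrite /gcdz -abszE !abs_u ?gcdn_gt0 ?i1 //.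
rewrite dvdn_gcd; case: (d %| i)%N; case: (d %| j)%N => //=.
- by rewrite gcdnn.
- by rewrite gcdn1.
- by rewrite gcd1n.
Qed.

Lemma strong_step2 (u : nat -> int) (eps : int) : eps = 1 \/ eps = -1 ->
  u 1%N = 1 -> (forall n : nat, (1 <= n)%N -> u n.+2 = eps * u n) ->
  strong_divisibility u.
Proof.
move=> eps1 u1 hu.
apply: (@strong_of_two_values 2 `|u 2%N|%N); elim/ltn_ind => -[//|[|[|n]]] IH _.
- by rewrite u1.
- by [].
rewrite hu // abszM IH // !dvdn2 /= !negbK mulnC.
by case: eps1 => ->; rewrite muln1.
Qed.

Lemma strong_step6 (u : nat -> int) (eps : int) : eps = 1 \/ eps = -1 ->
  u 1%N = 1 -> u 2%N = eps -> u 3%N = -2 -> u 4%N = eps -> u 5%N = 1 ->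
  u 6%N = -2 * eps ->
  (forall n : nat, (1 <= n)%N -> u (n + 6)%N = u n) ->
  strong_divisibility u.
Proof.
move=> eps1 u1 u2 u3 u4 u5 u6 hu; apply: (@strong_of_two_values 3 2).
elim/ltn_ind => -[//|[|[|[|[|[|[|n]]]]]]] IH _.
- by rewrite u1.
- by rewrite u2; case: eps1 => ->.
- by rewrite u3.
- by rewrite u4; case: eps1 => ->.
- by rewrite u5.
- by rewrite u6; case: eps1 => ->.
have -> : n.+3.+4 = (n.+1 + 6)%N by rewrite addnC.
by rewrite hu // (@dvdn_addl 6 3) // IH //; lia.
Qed.

(** * Bounds derived from divisibility *)

Lemma dvdz_norm_le (d m : int) : m != 0 -> (d %| m)%Z -> `|d| <= `|m|.
Proof. rewrite dvdzE => m0 /dvdn_leq H. have := H ltac:(lia). lia. Qed.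

Lemma square_eq1_or_ge4 (R : int) : R != 0 -> R * R = 1 \/ 4 <= R * R.
Proof. move=> R0; have [R2|R2] := leP 2 `|R|; [right; nia | left; nia]. Qed.

(** By the triangle inequality, a divisibility [e * p + q %| e] leaves room only
    for a multiplier [p] that is not much larger than the offset [q]. *)
Lemma norm_affine_bound (e p q : int) : e != 0 -> p != 0 ->
  (e * p + q %| e)%Z ->
  `|e| * (`|p| - 1) <= `|q| /\ `|p| - 1 <= `|q|.
Proof.
move=> e0 p0 /(dvdz_norm_le e0) le_e.
have ep : `|e| * (`|p| - 1) <= `|q|.
  rewrite mulrBr mulr1 -normrM.
  have := ler_normB (e * p + q) q; rewrite addrK; lia.
split=> //; apply: le_trans ep; rewrite ler_peMl; lia.
Qed.

(** With [s = 1], [a = u_3] and [P = (1 + a * e) R], the two divisors are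
    [u_4 / R] and [u_5].  The first hypothesis leaves finitely many pairs
    [(a, e)], and each of them is tested against both divisibilities. *)
Lemma ratio_cases_one (a e : int) : a != 0 -> a != 1 -> e != 0 ->
  (e * (a * (a - 1)) + (2 * a - 1) %| e)%Z ->
  ((1 + a * e) * (e * (a * (a - 1)) + (2 * a - 1)) - (1 + a * e - a) * a
    %| a * e)%Z ->
  [\/ a = -1 /\ e = 1, a = -1 /\ e = 2 | a = -2 /\ e = 1].
Proof.
move=> a0 a1 e0 dvd_be dvd_c.
have p0 : a * (a - 1) != 0 by rewrite mulf_neq0 // subr_eq0.
have [ep p_le] := norm_affine_bound e0 p0 dvd_be.
have a_in : a \in [:: -2; -1; 2; 3].
  rewrite !inE; move: a0 a1 p_le; clear; nia.
have e_in : e \in [:: -3; -2; -1; 1; 2; 3].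
  rewrite !inE in a_in *.
  by case/or4P: a_in ep => /eqP ->; move: e0; clear; lia.
rewrite !inE in a_in e_in.
case/or4P: a_in dvd_be dvd_c => /eqP ->;
  case/or4P: e_in => [/eqP ->|/eqP ->|/eqP ->|/or3P[]/eqP->];
  first [by constructor 1 | by constructor 2 | by constructor 3
        | by vm_compute].
Qed.

(** The same divisors when [s = R ^ 2 >= 4].  The divisibility coming from [u_4]
    forces [a] next to a zero of the quadratic [a * (a - s)] and [e] to be a
    sign; the sizes of both divisors then leave only the pairs with [P = 0]. *)
Lemma ratio_cases_four (s a e : int) : 4 <= s -> a != 0 -> a != s -> e != 0 ->
  (e * (a * (a - s)) + (2 * a - s) %| e)%Z ->
  ((1 + a * e) * s * (e * (a * (a - s)) + (2 * a - s))
      - ((1 + a * e) * s - a) * a  %| a * e)%Z ->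
  1 + a * e = 0.
Proof.
move=> s4 a0 a1 e0 dvd_be dvd_c.
have p0 : a * (a - s) != 0 by rewrite mulf_neq0 // subr_eq0.
have [ep p_le] := norm_affine_bound e0 p0 dvd_be.
(* [a * (a - s)] exceeds [2 * a - s] in size unless [a] is next to 0 or [s]. *)
have aE : [\/ a = -1, a = 1, a = s - 1 | a = s + 1].
  have : [|| a <= -2, a >= s + 2, 2 <= a <= s - 2, a == -1, a == 1,
            a == s - 1 | a == s + 1] by lia.
  case/or4P => [a_lt|a_gt|/andP[a_ge a_le]|].
  - have : 0 <= (-a - 2) * s by rewrite mulr_ge0; lia.
    move: s4 a_lt p_le; clear; nia.
  - have : 0 <= (a - s - 2) * a by rewrite mulr_ge0; lia.
    move: s4 a_gt p_le; clear; nia.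
  - have : 0 <= (a - 2) * (s - 2 - a) by rewrite mulr_ge0; lia.
    move: s4 a_ge a_le p_le; clear; nia.
  - by case/or4P=> /eqP ->; constructor.
have e1 : e = 1 \/ e = -1.
  case: aE => aE; move: ep e0 s4; rewrite aE; clear; nia.
have ae0 : a * e != 0 by rewrite mulf_neq0.
move: dvd_be dvd_c => /(dvdz_norm_le e0) le_be /(dvdz_norm_le ae0) le_c.
case: aE => aE; case: e1 => eE; subst a e; move: s4 le_be le_c; clear; nia.
Qed.

(** * Divisibility constraints on the parameters *)

Section Necessary.

Variables (P Q : int) (u : nat -> int).
Hypothesis hu1 : u 1%N = 1.
Hypothesis hu : satisfies_rec P Q u.
Hypothesis su : strong_divisibility u.
Local Notation R := (u 2%N).

Lemma strong_dvd i j : (1 <= i)%N -> (1 <= j)%N -> (i %| j)%N ->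
  (u i %| u j)%Z.
Proof.
move=> i1 j1 /gcdn_idPl ij; apply/gcdz_idPl.
by rewrite su // ij.
Qed.

Lemma strong_coprime i j : (1 <= i)%N -> (1 <= j)%N -> coprime i j ->
  coprimez (u i) (u j).
Proof. by move=> i1 j1 /eqP ij; rewrite /coprimez su // ij hu1. Qed.

Lemma strong_rec_coprime : coprimez R Q /\ coprimez P Q.
Proof.
have u3E : u 3%N = P * R - Q by rewrite (@hu 1) // hu1 mulr1.
have co23 : coprimez R (u 3%N) by apply: strong_coprime.
have co34 : coprimez (u 3%N) (u 4%N) by apply: strong_coprime.
have coRQ : coprimez R Q.
  by move: co23; rewrite u3E /coprimez gcdzMDl gcdzN.
split=> //.
have : coprimez (u 3%N) (Q * R).
  by move: co34; rewrite (@hu 2) // /coprimez gcdzMDl gcdzN.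
rewrite coprimezMr coprimez_sym => /andP[+ _].
have -> : u 3%N = (-1) * Q + P * R by rewrite u3E; ring.
rewrite /coprimez gcdzMDl -/(coprimez _ _) coprimez_sym coprimezMl.
by case/andP.
Qed.

(** [u_4 = (P ^ 2 - Q) R - P Q], where [R] is coprime to [Q]. *)
Lemma strong_rec_dvd_param : (R %| P)%Z.
Proof.
have [coRQ _] := strong_rec_coprime.
rewrite -(Gauss_dvdzl _ coRQ).
have -> : P * Q = (P * P - Q) * R - u 4%N.
  by rewrite (@hu 2) // (@hu 1) // hu1; ring.
by rewrite rpredB ?dvdz_mull // strong_dvd.
Qed.

(** [u_(2n) = u_(n+1) U_n] modulo [u_n], so [u_n] divides [U_n] and is thereby
    coprime to [U_(n-1)]; it then divides the factor [P - R] of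
    [U_n - u_n = (P - R) U_(n-1)]. *)
Lemma strong_rec_dvd n : (1 <= n)%N -> (u n %| P - R)%Z.
Proof.
case: n => // m _; have [_ coPQ] := strong_rec_coprime.
have uU : (u m.+1 %| lucasU P Q m.+1)%Z.
  have co : coprimez (u m.+1) (u m.+2).
    by apply: strong_coprime => //; rewrite coprimenS.
  rewrite -(Gauss_dvdzr _ co).
  have -> : u m.+2 * lucasU P Q m.+1
            = u (m.+1 + m.+1)%N + Q * lucasU P Q m * u m.+1.
    by rewrite (rec_add m hu) //; ring.
  rewrite rpredD ?dvdz_mull // strong_dvd ?addn_gt0 //.
  by rewrite addnn -muln2 dvdn_mulr.
have co : coprimez (u m.+1) (lucasU P Q m).
  have /dvdzP [q qE] := uU.
  have := coprime_lucasU_succ coPQ m.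
  by rewrite qE coprimezMl => /andP[].
rewrite -(Gauss_dvdzl _ co).
have -> : (P - R) * lucasU P Q m = lucasU P Q m.+1 - u m.+1.
  by rewrite (rec_lucasU m hu hu1); ring.
by rewrite rpredB.
Qed.

(** * The case analysis *)

(** Terms of odd index are coprime to [R], so they divide
    [k - 1 = (P - R) / R]; so does [u_4 / R].  The coprimality of [u_3] and
    [u_4 / R] strengthens this to [u_4 / R] dividing [(k - 1) / u_3]. *)
Lemma strong_rec_cases :
  [\/ P = R, P = 0 /\ (Q = 1 \/ Q = -1)
    | (R = 1 \/ R = -1) /\
      [\/ (exists k, P = k * R /\ Q = k - 1), P = - R /\ Q = 0
        | P = - R /\ Q = 1]].
Proof.
have [_ coPQ] := strong_rec_coprime.
have /dvdzP [k PE] := strong_rec_dvd_param.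
have P0case : P = 0 -> Q = 1 \/ Q = -1.
  move=> P0; move: coPQ; rewrite P0 /coprimez gcd0z => /eqP; lia.
have [->|/eqP PR] := eqVneq P R; first by constructor 1.
have [/[dup] /P0case|/eqP P0] := eqVneq P 0; first by constructor 2.
constructor 3.
have R0 : R != 0 by apply/eqP => R0; apply: P0; rewrite PE R0 mulr0.
have u3E : u 3%N = k * (R * R) - Q by rewrite (@hu 1) // hu1 PE; ring.
set a := u 3%N in u3E.
set b := k * a - Q.
have u4E : u 4%N = R * b by rewrite (@hu 2) // -/a PE /b; ring.
have u5E : u 5%N = k * (R * R) * b - Q * a by rewrite (@hu 3) // u4E -/a PE; ring.
have PRE : P - R = (k - 1) * R by rewrite PE; ring.
have odd_dvd n : odd n -> (u n %| k - 1)%Z.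
  move=> n_odd; have n1 : (1 <= n)%N by case: n n_odd.
  have co : coprimez (u n) R by apply: strong_coprime; rewrite // coprimen2.
  by rewrite -(Gauss_dvdzl _ co) -PRE strong_rec_dvd.
have b_dvd : (b %| k - 1)%Z.
  by rewrite -(dvdz_mul2l R0) -u4E mulrC -PRE strong_rec_dvd.
have co_ab : coprimez a b.
  have : coprimez a (u 4%N) by apply: strong_coprime.
  by rewrite u4E coprimezMr => /andP[].
have co_aR : coprimez a R by apply: strong_coprime.
have /dvdzP [e eE] : (a %| k - 1)%Z by apply: odd_dvd.
have kE : k = 1 + a * e by rewrite mulrC -eE; ring.
have QE : Q = k * (R * R) - a by rewrite u3E; ring.
have bE : b = e * (a * (a - R * R)) + (2 * a - R * R).
  by rewrite /b QE kE; ring.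
have k1 : k - 1 != 0.
  by apply/eqP => k1; apply: PR; apply/eqP; rewrite -subr_eq0 PRE k1 mul0r.
have [e0 a0] : e != 0 /\ a != 0.
  by move: k1; rewrite eE mulf_eq0 => /norP.
have b_dvd_e : (b %| e)%Z.
  by rewrite -(@Gauss_dvdzl b e a) -?eE // coprimez_sym.
have c_dvd : (u 5%N %| a * e)%Z by rewrite mulrC -eE odd_dvd.
rewrite bE in b_dvd_e; rewrite u5E bE QE kE in c_dvd.
have R1 : R * R = 1 -> R = 1 \/ R = -1 by move: (R); clear; nia.
(* Coprimality of [u_3] and [R] makes [R] a unit when [u_3 = R ^ 2]. *)
have [aR|aR] := eqVneq a (R * R).
  have RR1 : R * R = 1.
    move: co_aR; rewrite aR coprimezMl andbb /coprimez gcdzz.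
    by move: (R); clear; nia.
  split; first exact: R1.
  by constructor 1; exists k; split=> //; rewrite QE aR RR1 mulr1.
have [RR1|RR4] := square_eq1_or_ge4 R0; last first.
  by case: P0; rewrite PE kE (ratio_cases_four RR4 a0 aR e0) // mul0r.
split; first exact: R1.
rewrite RR1 mulr1 in aR b_dvd_e c_dvd QE.
have [[aE e1]|[aE e1]|[aE e1]] := ratio_cases_one a0 aR e0 b_dvd_e c_dvd.
- by case: P0; rewrite PE kE aE e1 mul0r.
- by constructor 2; rewrite PE QE kE aE e1; split; [ring|].
- by constructor 3; rewrite PE QE kE aE e1; split; [ring|].
Qed.

End Necessary.

Theorem mainTheorem1 (P Q R : int) (u : nat -> int)
  (hu1 : u 1%N = 1) (hu2 : u 2%N = R)
  (hu : forall n : nat, (1 <= n)%N -> u n.+2 = P * u n.+1 - Q * u n) :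
  strong_divisibility u <->
  (exists P' Q' : int, coprimez P' Q' /\
     (forall n : nat, (1 <= n)%N -> u n = lucasU P' Q' n))
  \/ (exists r eps : int, (eps = 1 \/ eps = -1) /\
        u 1%N = 1 /\ u 2%N = r /\
        (forall n : nat, (1 <= n)%N -> u n.+2 = eps * u n))
  \/ (exists eps : int, (eps = 1 \/ eps = -1) /\
        u 1%N = 1 /\
        (forall n : nat, (2 <= n)%N -> ~~ odd n -> u n = eps) /\
        (forall n : nat, (3 <= n)%N -> odd n -> u n = -1))
  \/ (exists eps : int, (eps = 1 \/ eps = -1) /\
        u 1%N = 1 /\ u 2%N = eps /\ u 3%N = -2 /\
        u 4%N = eps /\ u 5%N = 1 /\ u 6%N = -2 * eps /\
        (forall n : nat, (1 <= n)%N -> u (n + 6)%N = u n)).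
Proof.
split=> [su|].
- have := strong_rec_cases hu1 hu su; rewrite hu2.
  case=> [PR|[P0 Q1]|[R1 [[k [PE QE]]|[PE QE]|[PE QE]]]].
  + left; exists P, Q; split; first by case: (strong_rec_coprime hu1 hu su).
    case=> // m _; rewrite (rec_lucasU m hu hu1) hu2 PR; ring.
  + right; left; exists R, (- Q); split; first by case: Q1 => ->; [right|left].
    by do 2!split=> //; move=> n n1; rewrite hu // P0; ring.
  (* Here the ratio of consecutive terms is constantly [R]. *)
  + have uS n : u n.+2 = R * u n.+1.
      elim: n => [|n IH]; first by rewrite hu2 hu1 mulr1.
      by rewrite hu // IH PE QE; case: R1 => ->; ring.
    right; left; exists R, 1; split; first by left.
    do 2!split=> //; case=> // n _; rewrite !uS.
    by case: R1 => ->; ring.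
  + right; right; left; exists R; split=> //; split=> //.
    have uE n : u n.+2 = if odd n then -1 else R.
      elim: n => [|n IH] //=; rewrite hu // IH PE QE mul0r subr0.
      by case: (odd n) => /=; case: R1 => ->.
    split=> -[|[|n]] //= _; rewrite uE !negbK => n_odd.
      by rewrite ifN.
    by rewrite n_odd.
  + right; right; right; exists R; split=> //.
    (* The companion polynomial [X ^ 2 + R X + 1] divides [X ^ 3 - R]. *)
    have uS n : (1 <= n)%N -> u n.+3 = R * u n.
      by move=> n1; rewrite !hu // PE QE; case: R1 => ->; ring.
    have u3 : u 3%N = -2 by rewrite hu // hu2 hu1 PE QE; case: R1 => ->.
    rewrite (@uS 1) // (@uS 2) // (@uS 3) // hu1 hu2 u3; do !split=> //.
    * by rewrite mulr1.
    * by case: R1 => ->.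
    * by case: R1 => ->.
    * move=> n n1; rewrite addnC (@uS n.+3) // uS //; case: R1 => ->; ring.
- case=> [[P' [Q' [co uE]]]|[[r [eps [eps1 [u1 [_ hr]]]]]|]].
  + move=> i j i1 j1; rewrite !uE ?gcdn_gt0 ?i1 //.
    exact: strong_lucasU co i j i1 j1.
  + exact: strong_step2 eps1 u1 hr.
  + case=> [[eps [eps1 [u1 [u_even u_odd]]]]|].
    * apply: (@strong_of_two_values 1 1) => -[|[|n]] // _; first by rewrite u1.
      rewrite dvd1n; case: (boolP (odd n)) => n_odd.
        by rewrite u_odd //=; [case: n n_odd | rewrite negbK].
      by rewrite u_even //= ?negbK //; case: eps1 => ->.
    * case=> eps [eps1 [u1 [u2 [u3 [u4 [u5 [u6 hu6]]]]]]].
      exact: strong_step6 eps1 u1 u2 u3 u4 u5 u6 hu6.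
Qed.
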